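(* Let $K$ be a dp-bi-Kleene algebra (defined in the context). Then for all $x,y,p,q\in K$ the following hold: (a) $\langle x+y\rangle p=\langle x\rangle p+\langle y\rangle p$; (b) $\langle x\cdot y\rangle p=\langle x\rangle\langle y\rangle p$; (c) $\langle d(p)\rangle q=d(p)\cdot d(q)$; (d) $\langle x\| y\rangle p=\langle x\rangle p\cdot\langle y\rangle p$; (e) $d(p)+\langle x\rangle\langle x^\ast\rangle p=\langle x^\ast\rangle p$; (f) if $\langle x\rangle p\le d(p)$ then $\langle x^\ast\rangle p\le d(p)$. In particular, for domain elements $p$ (i.e. $p=d(p)$), these are algebraic forms of the diamond axioms of Peleg's concurrent dynamic logic.
   Context: A proto-dioid is a structure $(S,+,\cdot,0,1_\sigma)$ such that $+$ is associative, commutative and idempotent with unit $0$ (ordered by $x\le y\iff x+y=y$), and $1_\sigma\cdot x=x$, $x\cdot 1_\sigma=x$, $x\cdot y+x\cdot z\le x\cdot(y+z)$, $(x+y)\cdot z=x\cdot z+y\cdot z$, $0\cdot x=0$ (multiplication need not be associative). A proto-trioid $(S,+,\cdot,\|,0,1_\sigma,1_\pi)$ is a proto-dioid $(S,+,\cdot,0,1_\sigma)$ such that $\|$ is associative and commutative with unit $1_\pi$, $x\|(y+z)=x\|y+x\|z$ and $x\|0=0$. A dp-dioid is a proto-dioid with a unary operation $d$ such that $x\cdot(y\cdot z)=(x\cdot y)\cdot z$ whenever one of $x,y,z$ equals $d(w)$ for some $w$, and $x\le d(x)\cdot x$, $d(x\cdot y)=d(x\cdot d(y))$, $d(x+y)=d(x)+d(y)$,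 $d(x)\le 1_\sigma$, $d(0)=0$. A dp-trioid is a dp-dioid which is also a proto-trioid and satisfies $(x\|y)\cdot d(z)=(x\cdot d(z))\|(y\cdot d(z))$, $d(x\|y)=d(x)\cdot d(y)$, $d(x)\|d(y)=d(x)\cdot d(y)$. A dp-Kleene algebra is a dp-dioid with a unary operation $^\ast$ satisfying $1_\sigma+x\cdot x^\ast\le x^\ast$ and $d(z)+x\cdot y\le y\Rightarrow x^\ast\cdot d(z)\le y$. A dp-bi-Kleene algebra is a dp-Kleene algebra which is also a dp-trioid. The diamond is defined by $\langle x\rangle y=d(x\cdot y)$. *)

(* Defs.v *)
From HB Require Import structures.
From mathcomp Require Import ssreflect ssrfun.

Set Implicit Arguments.
Unset Strict Implicit.
Unset Printing Implicit Defensive.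

Declare Scope dioid_scope.
Delimit Scope dioid_scope with dioid.

(* Carriers are plain types: MathComp's additive structures would impose a
   choice operator on them. *)
HB.mixin Record isJoinSemilattice (S : Type) := {
  zero : S;
  add : S -> S -> S;
  addA : associative add;
  addC : commutative add;
  addxx : idempotent_op add;
  add0x : left_id zero add
}.
#[short(type="joinSemilatType")]
HB.structure Definition JoinSemilat := {S of isJoinSemilattice S}.

Notation "0" := zero : dioid_scope.
Notation "x + y" := (add x y) : dioid_scope.

Definition le (S : joinSemilatType) (x y : S) : Prop := (x + y)%dioid = y.

Notation "x <= y" := (le x y) : dioid_scope.

Local Open Scope dioid_scope.

(* Sequential composition [mul] is neither associative nor left distributive. *)
HB.mixin Record JoinSemilat_isProtoDioid S of JoinSemilat S := {
  sunit : S;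
  mul : S -> S -> S;
  mul1x : left_id sunit mul;
  mulx1 : right_id sunit mul;
  mulDr_sub : forall x y z : S, mul x y + mul x z <= mul x (y + z);
  mulDl : forall x y z : S, mul (x + y) z = mul x z + mul y z;
  mul0x : left_zero 0 mul
}.
#[short(type="protoDioidType")]
HB.structure Definition ProtoDioid :=
  {S of JoinSemilat S & JoinSemilat_isProtoDioid S}.

Notation "1" := sunit : dioid_scope.
Notation "x * y" := (mul x y) : dioid_scope.

HB.mixin Record ProtoDioid_isProtoTrioid S of ProtoDioid S := {
  punit : S;
  par : S -> S -> S;
  parA : associative par;
  parC : commutative par;
  par1x : left_id punit par;
  parDr : forall x y z : S, par x (y + z) = par x y + par x z;
  parx0 : right_zero 0 par
}.
#[short(type="protoTrioidType")]
HB.structure Definition ProtoTrioid :=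
  {S of ProtoDioid S & ProtoDioid_isProtoTrioid S}.

Notation "x || y" := (par x y) : dioid_scope.

HB.mixin Record ProtoDioid_isDpDioid S of ProtoDioid S := {
  d : S -> S;
  mulA_d : forall x y z : S,
    (exists w, x = d w \/ y = d w \/ z = d w) -> x * (y * z) = (x * y) * z;
  le_d_mul : forall x : S, x <= d x * x;
  d_mul : forall x y : S, d (x * y) = d (x * d y);
  d_add : forall x y : S, d (x + y) = d x + d y;
  d_le1 : forall x : S, d x <= 1;
  d0 : d 0 = 0
}.
#[short(type="dpDioidType")]
HB.structure Definition DpDioid := {S of ProtoDioid S & ProtoDioid_isDpDioid S}.

HB.mixin Record DpDioid_isDpTrioid S of DpDioid S & ProtoTrioid S := {
  par_mul_d : forall x y z : S, (x || y) * d z = (x * d z) || (y * d z);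
  d_par : forall x y : S, d (x || y) = d x * d y;
  par_d : forall x y : S, d x || d y = d x * d y
}.
#[short(type="dpTrioidType")]
HB.structure Definition DpTrioid :=
  {S of DpDioid S & ProtoTrioid S & DpDioid_isDpTrioid S}.

HB.mixin Record DpDioid_isDpKleene S of DpDioid S := {
  star : S -> S;
  star_unfold : forall x : S, 1 + x * star x <= star x;
  star_induct : forall x y z : S, d z + x * y <= y -> star x * d z <= y
}.
#[short(type="dpKleeneType")]
HB.structure Definition DpKleene := {S of DpDioid S & DpDioid_isDpKleene S}.

#[short(type="dpBiKleeneType")]
HB.structure Definition DpBiKleene := {S of DpKleene S & DpTrioid S}.

Definition diamond (S : dpDioidType) (x y : S) : S := d (x * y).

(* Main.v *)
(** Every reassociation needed below involves a domain element, so the missing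
    associativity of [*] does no harm. Domain elements multiply as meets, which
    gives (c). Since [d 1 = 1], star induction makes [star x] a genuine fixpoint
    of [y |-> 1 + x * y], and (e) is the diamond of this equation. For (f), the
    condition [diamond x p <= d p] amounts to the commutation
    [x * d p <= d p * x], which star induction lifts from [x] to [star x]. *)

Require Import Defs.
From mathcomp Require Import ssreflect.

Set Implicit Arguments.
Unset Strict Implicit.
Unset Printing Implicit Defensive.

Local Open Scope dioid_scope.

Section JoinSemilattice.
Variable S : joinSemilatType.
Implicit Types x y z : S.

Lemma le_refl x : x <= x.
Proof. exact: addxx. Qed.

Lemma le_trans y x z : x <= y -> y <= z -> x <= z.
Proof. by rewrite /le => xy <-; rewrite addA xy. Qed.

Lemma le_anti x y : x <= y -> y <= x -> x = y.
Proof. by rewrite /le => xy yx; rewrite -xy addC yx. Qed.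

Lemma le_addl x y : x <= x + y.
Proof. by rewrite /le addA addxx. Qed.

Lemma le_addr x y : y <= x + y.
Proof. by rewrite addC; apply: le_addl. Qed.

Lemma add_le x y z : x <= z -> y <= z -> x + y <= z.
Proof. by rewrite /le -addA => xz ->. Qed.

Lemma le_add2l z x y : x <= y -> z + x <= z + y.
Proof.
move=> xy; apply: add_le; first exact: le_addl.
exact: le_trans xy (le_addr _ _).
Qed.

End JoinSemilattice.

Section ProtoDioid.
Variable S : protoDioidType.
Implicit Types x y z : S.

Lemma le_mul2r z x y : x <= y -> x * z <= y * z.
Proof. by rewrite /le -mulDl => ->. Qed.

Lemma le_mul2l z x y : x <= y -> z * x <= z * y.
Proof.
move=> xy; rewrite -xy.
exact: le_trans (le_addl _ _) (mulDr_sub _ _ _).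
Qed.

Lemma le_mul x x' y y' : x <= x' -> y <= y' -> x * y <= x' * y'.
Proof.
by move=> xx' yy'; apply: le_trans (le_mul2r _ xx') (le_mul2l _ yy').
Qed.

End ProtoDioid.

Section DpDioid.
Variable S : dpDioidType.
Implicit Types x y z p q r : S.

Lemma mulA_dl x y z : d x * (y * z) = d x * y * z.
Proof. by apply: mulA_d; exists x; left. Qed.

Lemma mulA_dm x y z : x * (d y * z) = x * d y * z.
Proof. by apply: mulA_d; exists y; right; left. Qed.

Lemma mulA_dr x y z : x * (y * d z) = x * y * d z.
Proof. by apply: mulA_d; exists z; right; right. Qed.

Lemma le_d x y : x <= y -> d x <= d y.
Proof. by rewrite /le -d_add => ->. Qed.

Lemma d_idem x : d (d x) = d x.
Proof. by rewrite -[d x in LHS]mul1x -d_mul mul1x. Qed.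

Lemma mul_d_le x y : x * d y <= x.
Proof. by rewrite -[X in _ <= X]mulx1; apply/le_mul2l/d_le1. Qed.

Lemma d_mul_le x y : d x * y <= y.
Proof. by rewrite -[X in _ <= X]mul1x; apply/le_mul2r/d_le1. Qed.

Lemma le1_le_d x : x <= 1 -> x <= d x.
Proof.
move=> x1; rewrite -[X in _ <= X]mulx1.
exact: le_trans (le_d_mul _) (le_mul2l _ x1).
Qed.

Lemma d1 : d 1 = 1 :> S.
Proof. by apply: le_anti (d_le1 _) (le1_le_d (le_refl _)). Qed.

Lemma d_le_mul_d p q r : d r <= d p -> d r <= d q -> d r <= d p * d q.
Proof.
move=> rp rq; apply: le_trans (le_mul rp rq).
by rewrite -{2}[d r]d_idem; apply: le_d_mul.
Qed.

Lemma d_mul_d p q : d (d p * d q) = d p * d q.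
Proof.
apply: le_anti.
- apply: d_le_mul_d; rewrite -[X in _ <= X]d_idem.
  + exact/le_d/mul_d_le.
  + exact/le_d/d_mul_le.
- exact: le1_le_d (le_trans (mul_d_le _ _) (d_le1 _)).
Qed.

Lemma diamond_add x y p : diamond (x + y) p = diamond x p + diamond y p.
Proof. by rewrite /diamond mulDl d_add. Qed.

Lemma diamond_mul x y p : diamond (x * y) p = diamond x (diamond y p).
Proof. by rewrite /diamond d_mul -mulA_dr d_mul -[d (y * d p)]d_mul. Qed.

Lemma diamond1 p : diamond 1 p = d p.
Proof. by rewrite /diamond mul1x. Qed.

Lemma diamond_d p q : diamond (d p) q = d p * d q.
Proof. by rewrite /diamond d_mul d_mul_d. Qed.

Lemma diamond_le_d x p q : diamond x p <= d q <-> x * d p <= d q * x.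
Proof.
rewrite /diamond d_mul; split=> [le_dq | xpq].
- apply: le_trans (le_d_mul _) _.
  exact: le_mul le_dq (mul_d_le _ _).
- apply: le_trans (le_d xpq) _.
  by rewrite d_mul d_mul_d; apply: mul_d_le.
Qed.

End DpDioid.

Section DpTrioid.
Variable S : dpTrioidType.
Implicit Types x y p : S.

Lemma diamond_par x y p : diamond (x || y) p = diamond x p * diamond y p.
Proof. by rewrite /diamond d_mul par_mul_d d_par -!d_mul. Qed.

End DpTrioid.

Section DpKleene.
Variable S : dpKleeneType.
Implicit Types x y p : S.

Lemma star_ge1 x : 1 <= star x.
Proof. exact: le_trans (le_addl _ _) (star_unfold x). Qed.

Lemma mul_star_le x : x * star x <= star x.
Proof. exact: le_trans (le_addr _ _) (star_unfold x). Qed.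

Lemma star_le x y : 1 + x * y <= y -> star x <= y.
Proof. by rewrite -[star x]mulx1 -d1; apply: star_induct. Qed.

Lemma star_fixpoint x : 1 + x * star x = star x.
Proof.
apply: le_anti (star_unfold x) _; apply: star_le.
exact/le_add2l/le_mul2l/star_unfold.
Qed.

Lemma star_mul_d_le x y p :
  x * d p <= d p * y -> star x * d p <= d p * star y.
Proof.
move=> xpy; apply: star_induct; apply: add_le.
- by rewrite -{1}[d p]mulx1; apply/le_mul2l/star_ge1.
- rewrite mulA_dm; apply: le_trans (le_mul2r _ xpy) _.
  by rewrite -mulA_dl; apply/le_mul2l/mul_star_le.
Qed.

Lemma diamond_star_unfold x p :
  d p + diamond x (diamond (star x) p) = diamond (star x) p.
Proof. by rewrite -diamond1 -diamond_mul -diamond_add star_fixpoint. Qed.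

Lemma diamond_star_induct x p :
  diamond x p <= d p -> diamond (star x) p <= d p.
Proof. by move/diamond_le_d=> xpp; apply/diamond_le_d/star_mul_d_le. Qed.

End DpKleene.

Theorem theorem10p12 (K : dpBiKleeneType) (x y p q : K) :
  (diamond (x + y) p = diamond x p + diamond y p) /\
  (diamond (x * y) p = diamond x (diamond y p)) /\
  (diamond (d p) q = d p * d q) /\
  (diamond (x || y) p = diamond x p * diamond y p) /\
  (d p + diamond x (diamond (star x) p) = diamond (star x) p) /\
  (diamond x p <= d p -> diamond (star x) p <= d p).
Proof.
split; first exact: diamond_add.
split; first exact: diamond_mul.
split; first exact: diamond_d.
split; first exact: diamond_par.
split; first exact: diamond_star_unfold.
exact: diamond_star_induct.
Qed.
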